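(* Let $p$ be a prime, $n\ge 1$, $q=p^n$. For $P\in \mathbb{F}_q[x]$, set $P_0(x)=P(x)-P(0)$ and let $V=V(P,q)$ be the set of all elements $y\in\mathbb{F}_q$ for which the identity $$P_0(x+y)-P_0(x)-P_0(y)=0$$ holds in $\mathbb{F}_q[x]$. Let $\mathcal{L}\in\mathbb{F}_q[x]$ be defined by $\mathcal{L}(x)=\prod_{v\in V}(x-v)$. Then: (i) $\mathcal{L}$ is a subspace polynomial over $\mathbb{F}_q$, that is, a monic $p$-linearized polynomial that divides $x^q-x$; (ii) for any monic $p$-linearized polynomial $L\in\mathbb{F}_q[x]$ dividing $x^q-x$, $P$ is $L$-decomposable if and only if $L$ divides $\mathcal{L}$.
   Context: A $p$-linearized polynomial is a polynomial of the form $\sum_{i=0}^m a_i x^{p^i}$ with $a_i\in\overline{\mathbb{F}}_p$ (the zero polynomial is allowed). A subspace polynomial over $\mathbb{F}_q$ is a monic $p$-linearized polynomial in $\mathbb{F}_q[x]$ dividing $x^q-x$. For a subspace polynomial $L$ over $\mathbb{F}_q$, a polynomial $P\in\mathbb{F}_q[x]$ is called $L$-decomposable if it can be written as $P(x)=f(L(x))+M(x)$ with $f,M\in\mathbb{F}_q[x]$ and $M$ a $p$-linearized polynomial with $\deg(M)<\deg(L)$ (where $M=0$ is allowed). *)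

(* Defs.v *)
From HB Require Import structures.
From mathcomp Require Import all_boot all_order all_algebra all_field.

Set Implicit Arguments.
Unset Strict Implicit.
Unset Printing Implicit Defensive.

Import GRing.Theory.
Local Open Scope ring_scope.

(* For a polynomial over a finite field F of characteristic p, the coefficients
   a i, a priori in the algebraic closure, are coefficients of the polynomial
   itself, hence lie in F. The zero polynomial is allowed. *)
Definition p_linearized (p : nat) (F : fieldType) (L : {poly F}) : Prop :=
  exists (m : nat) (a : 'I_m.+1 -> F), L = \sum_(i < m.+1) a i *: 'X^(p ^ i).

Definition subspace_poly (p : nat) (F : finFieldType) (L : {poly F}) : Prop :=
  [/\ L \is monic, p_linearized p L & L %| 'X^#|F| - 'X].

(* The strict inequality on sizes is deg M < deg L with deg 0 = -oo. *)
Definition decomposable (p : nat) (F : fieldType) (L P : {poly F}) : Prop :=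
  exists f M : {poly F},
    [/\ P = f \Po L + M, p_linearized p M & (size M < size L)%N].

Definition poly0 (F : fieldType) (P : {poly F}) : {poly F} := P - P.[0]%:P.

Definition additive_shifts (F : finFieldType) (P : {poly F}) : {set F} :=
  [set y : F |
    poly0 P \Po ('X + y%:P) - poly0 P - (poly0 P).[y]%:P == 0].

Definition shift_poly (F : finFieldType) (P : {poly F}) : {poly F} :=
  \prod_(v in additive_shifts P) ('X - v%:P).

(* Main.v *)
Require Import Defs.
From HB Require Import structures.
From mathcomp Require Import all_boot all_order all_algebra all_field.

(** Everything rests on how a polynomial behaves under the shifts x |-> x + y.

    A polynomial c with c(x+y) = c(x) + c(y) for all y in a set W containing 0,
    of degree at most #|W|, is p-linearized (p_linearized_of_additive_on): the
    identity holds for more values of y than its degree in y allows, so it holds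
    formally, and then Lucas-type binomial coefficients remove every exponent
    that is not a power of p.

    For (i), the set V is closed under addition, so the product over V of the
    x - v is unchanged by shifts in V; it vanishes on V and has degree #|V|, so
    the previous fact applies. It divides x^q - x, the product over all of F.

    For (ii), let W be the set of roots of L; L is the product of the x - w for
    w in W, so L divides the shift polynomial if and only if W is contained in
    V. If P = f(L) + M, then f(L) is W-periodic and M is additive, whence
    W lies in V. Conversely, if W lies in V, divide P - P(0) by L. By uniqueness
    of division the quotient is W-periodic, hence a polynomial in L
    (periodic_comp), while the remainder is additive on W and of degree less
    than #|W|, hence p-linearized. *)

Set Implicit Arguments.
Unset Strict Implicit.
Unset Printing Implicit Defensive.

Import GRing.Theory.
Local Open Scope ring_scope.

(** * From additivity on a set to linearized polynomials *)

Lemma comp_poly_shift_taylor (R : comNzRingType) (c : {poly R}) (y : R) :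
  c \Po ('X + y%:P) = \sum_(i < size c) c^`N(i) * y%:P ^+ i.
Proof.
rewrite /comp_poly nderiv_taylor; last exact: mulrC.
rewrite size_map_polyC; apply: eq_bigr => i _.
by rewrite nderivn_map -/(comp_poly 'X _) comp_polyXr.
Qed.

Lemma exprDn_pcharX (R : comNzRingType) (p e : nat) (x y : R) :
  p \in [pchar R] -> (x + y) ^+ (p ^ e) = x ^+ (p ^ e) + y ^+ (p ^ e).
Proof.
move=> charp; rewrite exprDn_pchar // (eq_pnat _ (pcharf_eq charp)).
by rewrite pnatX pnat_id ?(pcharf_prime charp).
Qed.

(** In characteristic p, (1 + x)^(m p^e) = (1 + x^(p^e))^m, and the coefficient
    of x^(p^e) on the right is m. This is the case of Lucas' theorem that
    separates powers of p from all other exponents. *)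
Lemma binomial_pfactor_neq0 (p : nat) (F : fieldType) (e m : nat) :
  p \in [pchar F] -> ~~ (p %| m)%N -> 'C(m * p ^ e, p ^ e)%:R != 0 :> F.
Proof.
move=> charp pNm.
have pe_gt0 : (0 < p ^ e)%N by rewrite expn_gt0 prime_gt0 ?(pcharf_prime charp).
have coefE k i : (('X + 1 : {poly F}) ^+ k)`_i = 'C(k, i)%:R.
  rewrite exprD1n coef_sum.
  under eq_bigr => j _ do rewrite coefMn coefXn.
  case: (ltnP i k.+1) => [ltik|leki].
    rewrite (bigD1 (Ordinal ltik)) //= eqxx big1 ?addr0 // => j neq.
    by rewrite eq_sym (negbTE (neq : val j != i)) mul0rn.
  rewrite bin_small // big1 // => j _.
  by rewrite gtn_eqF ?mul0rn // (leq_trans (ltn_ord j)).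
rewrite -coefE mulnC exprM exprDn_pcharX ?pchar_poly // expr1n.
have -> : ('X^(p ^ e) + 1 : {poly F}) ^+ m = ('X + 1) ^+ m \Po 'X^(p ^ e).
  by rewrite rmorphXn /= comp_polyD comp_polyX comp_polyC.
rewrite coef_comp_poly_Xn // dvdnn divnn pe_gt0 coefE bin1.
by rewrite -(dvdn_pcharf charp).
Qed.

Lemma p_linearized_coef (p : nat) (F : fieldType) (c : {poly F}) :
  (1 < p)%N -> (forall k, (forall e, k <> p ^ e)%N -> c`_k = 0) ->
  p_linearized p c.
Proof.
(* The bound size c on the exponents e is large enough because e < p^e. *)
move=> p_gt1 c0; exists (size c), (fun i => c`_(p ^ i)).
apply/polyP => k; rewrite coef_sum.
under eq_bigr => i _ do rewrite coefZ coefXn.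
have [/existsP[i /eqP kE]|noe] :=
  boolP [exists i : 'I_(size c).+1, k == p ^ i]%N.
  rewrite (bigD1 i) //= kE eqxx mulr1 big1 ?addr0 // => j neq.
  rewrite eqn_exp2l //; case: eqP => [ij|_]; last by rewrite mulr0.
  by case/eqP: neq; apply: val_inj.
rewrite big1 => [|i _]; last first.
  case: eqP => [kE|_]; last by rewrite mulr0.
  by case/existsP: noe; exists i; apply/eqP.
have [ltk|lek] := ltnP k (size c); last by rewrite nth_default.
apply: c0 => e kE; case/existsP: noe.
have lte : (e < (size c).+1)%N.
  by rewrite ltnS ltnW // (leq_trans _ ltk) // kE ltnS ltnW // ltn_expl.
by exists (Ordinal lte); apply/eqP.
Qed.

(** If W is large compared with the degree of c, additivity of c along the
    shifts in W forces c(x+y) = c(x) + c(y) as an identity in two variables: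
    the difference of the two sides, as a polynomial in y, has too many roots.
    Comparing coefficients in its Taylor expansion, each Hasse derivative of c
    of positive order is constant, so c_k 'C(k, i) = 0 for 0 < i < k, which
    kills c_k unless k is 0 or a power of p; the shift 0 gives c_0 = 0. The
    slack of one in the size bound makes the lemma cover both the remainders
    modulo a polynomial with root set W and that polynomial itself. *)
Lemma p_linearized_of_additive_on (p : nat) (F : finFieldType) (W : {set F})
    (c : {poly F}) :
  p \in [pchar F] -> 0 \in W -> (size c <= #|W|.+1)%N ->
  {in W, forall y, c \Po ('X + y%:P) = c + (c.[y])%:P} -> p_linearized p c.
Proof.
move=> charp W0 szc addc.
have p_prime := pcharf_prime charp.
have c00 : c`_0 = 0.
  have /eqP := addc 0 W0; rewrite addr0 comp_polyXr -subr_eq0 opprD addNKr.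
  by rewrite oppr_eq0 polyC_eq0 horner_coef0 => /eqP.
pose g i : {poly F} := c^`N(i) - (c`_i)%:P.
pose h i := if i == 0%N then 0 else g i.
(* Q(y) = c(x+y) - c(x) - c(y), read as a polynomial in y over F[x]. The bound
   (size c).-1 drops the leading term, which cancels because the top Hasse
   derivative of c is the leading coefficient of c. *)
pose Q : {poly {poly F}} := \poly_(i < (size c).-1) h i.
have glast : g (size c).-1 = 0.
  apply/polyP => j; rewrite coefB coef_nderivn coefC coef0.
  case: j => [|j]; first by rewrite addn0 binn mulr1n subrr.
  rewrite nth_default ?mul0rn ?subr0 //.
  by case: (size c) => [|s] //=; rewrite addnS ltnS leq_addr.
have Qroot y : y \in W -> root Q y%:P.
  move=> Wy; apply/rootP; rewrite horner_poly.
  have [sc0|sc_gt0] := posnP (size c); first by rewrite sc0 big_ord0.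
  have -> : \sum_(i < (size c).-1) h i * y%:P ^+ i =
            \sum_(i < size c) h i * y%:P ^+ i.
    rewrite -[in RHS](prednK sc_gt0) big_ord_recr /= {3}/h glast.
    by case: ifP; rewrite mul0r addr0.
  have := addc y Wy; rewrite comp_poly_shift_taylor horner_coef rmorph_sum /=.
  rewrite -(prednK sc_gt0) !big_ord_recl /= nderivn0 c00 !expr0 mulr1 mul0r.
  rewrite {1}/h /= mul0r polyC0 !add0r => /addrI sumE.
  under eq_bigr => i _ do rewrite /h /= /g mulrBl.
  rewrite sumrB sumE; apply/eqP; rewrite subr_eq0; apply/eqP/eq_bigr => i _.
  by rewrite polyCM polyC_exp.
(* Q has the #|W| roots y in W, and degree less than #|W|. *)
have Q0 : Q = 0.
  apply/eqP/contraT => nzQ.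
  have := @max_poly_roots _ Q [seq y%:P | y <- enum W] nzQ.
  rewrite map_inj_uniq ?enum_uniq; last exact: polyC_inj.
  rewrite size_map -cardE => /(_ _ isT) ltWQ.
  have : (size Q <= #|W|)%N.
    by apply: leq_trans (size_poly _ _) _; case: (size c) szc.
  rewrite leqNgt ltWQ //; apply/allP => _ /mapP[y Wy ->].
  by apply: Qroot; rewrite mem_enum in Wy.
apply: p_linearized_coef => [|k notpow]; first exact: prime_gt1.
case: (posnP k) => [-> //|k_gt0].
have [m copm kE] := pfactor_coprime p_prime k_gt0.
set e := logn p k in kE.
have pe_gt0 : (0 < p ^ e)%N by rewrite expn_gt0 prime_gt0.
(* The coefficient of x^(k - p^e) in g (p^e) is c_k times a binomial that is
   nonzero in F, and k > p^e since k is no power of p; hence c_k = 0. *)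
have m_gt1 : (1 < m)%N.
  case: m copm kE => [|[|m]] // _ kE; first by rewrite kE in k_gt0.
  by case: (notpow e); rewrite kE mul1n.
have ltpk : (p ^ e < k)%N by rewrite kE -{1}[(p ^ e)%N]mul1n ltn_pmul2r.
have [ltk|/leq_sizeP->//] := ltnP k (size c).
have g0 : g (p ^ e)%N = 0.
  have /polyP/(_ (p ^ e)%N) := Q0.
  rewrite coef_poly coef0 /h gtn_eqF // ifT //.
  by rewrite (leq_trans ltpk) // -ltnS prednK // (leq_ltn_trans _ ltk).
have /polyP/(_ (k - p ^ e)%N) := g0.
rewrite coefB coef_nderivn coefC coef0 subnKC; last exact: ltnW.
rewrite subn_eq0 leqNgt ltpk /= subr0 => /eqP.
rewrite -mulr_natr mulf_eq0 => /orP[/eqP //|]; rewrite {1}kE.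
rewrite (negbTE (binomial_pfactor_neq0 _ charp _)) //.
by rewrite -prime_coprime.
Qed.

Lemma p_linearized_shift (p : nat) (F : fieldType) (M : {poly F}) (y : F) :
  p \in [pchar F] -> p_linearized p M ->
  M \Po ('X + y%:P) = M + (M.[y])%:P.
Proof.
move=> charp [m [a ->]].
rewrite raddf_sum horner_sum rmorph_sum -big_split /=; apply: eq_bigr => i _.
rewrite comp_polyZ comp_Xn_poly hornerZ hornerXn polyCM polyC_exp.
by rewrite exprDn_pcharX ?pchar_poly // scalerDr -!mul_polyC.
Qed.

Lemma p_linearized_horner0 (p : nat) (F : fieldType) (M : {poly F}) :
  p \in [pchar F] -> p_linearized p M -> M.[0] = 0.
Proof.
move=> charp /(p_linearized_shift 0 charp) /eqP.
by rewrite addr0 comp_polyXr -subr_eq0 opprD addNKr oppr_eq0 polyC_eq0 => /eqP.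
Qed.

(** * Polynomials that split with simple roots *)

(** A divisor of x^q - x splits over F with simple roots, so it is recovered
    from its set of roots. *)
Lemma subspace_poly_roots (F : finFieldType) (L : {poly F}) :
  L \is monic -> L %| 'X^#|F| - 'X ->
  L = \prod_(v in [set x | root L x]) ('X - v%:P).
Proof.
move=> monL; rewrite finField_genPoly => /dvdp_prod_XsubC[m].
set s := mask m _; rewrite eqp_monic ?monic_prod_XsubC // => /eqP LE.
rewrite [LHS]LE -big_enum /=; apply: perm_big.
apply: uniq_perm; rewrite ?enum_uniq ?mask_uniq ?index_enum_uniq //.
by move=> x; rewrite mem_enum inE LE root_prod_XsubC.
Qed.

Lemma size_prod_set (F : finFieldType) (W : {set F}) :
  size (\prod_(v in W) ('X - v%:P)) = #|W|.+1.
Proof. by rewrite -big_enum size_prod_XsubC -cardE. Qed.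

Lemma root_prod_set (F : finFieldType) (W : {set F}) (x : F) :
  root (\prod_(v in W) ('X - v%:P)) x = (x \in W).
Proof. by rewrite -big_enum root_prod_XsubC mem_enum. Qed.

Lemma dvdp_prod_set (F : finFieldType) (W V : {set F}) :
  (\prod_(v in W) ('X - v%:P) %| \prod_(v in V) ('X - v%:P)) = (W \subset V).
Proof.
apply/idP/subsetP => [WV x | WV].
  by rewrite -!root_prod_set -!dvdp_XsubCl => /dvdp_trans; apply.
rewrite -big_enum /=; apply: uniq_roots_dvdp; last first.
  by rewrite uniq_rootsE enum_uniq.
by apply/allP => x; rewrite mem_enum root_prod_set => /WV.
Qed.

(** * Division by a periodic polynomial *)

(** Translating G = (G / L) L + (G mod L) by a period y of L gives a Euclidean
    division by the same L; uniqueness of quotient and remainder transfers the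
    behaviour of G under the shift to both. *)
Lemma edivp_shift (F : fieldType) (L G : {poly F}) (y b : F) :
  (1 < size L)%N -> L \Po ('X + y%:P) = L ->
  G \Po ('X + y%:P) = G + b%:P ->
  (G %/ L) \Po ('X + y%:P) = G %/ L /\
  (G %% L) \Po ('X + y%:P) = G %% L + b%:P.
Proof.
move=> szL Ly Gy.
have szb : (size b%:P < size L)%N by rewrite (leq_ltn_trans (size_polyC_leq1 _)).
have szR : (size ((G %% L) \Po ('X + y%:P)) < size L)%N.
  by rewrite size_comp_poly2 ?size_XaddC // ltn_modp -size_poly_gt0 ltnW.
have GE : G + b%:P = (G %/ L \Po ('X + y%:P)) * L + (G %% L \Po ('X + y%:P)).
  by rewrite -Gy {1}(divp_eq G L) comp_polyD comp_polyM Ly.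
split.
  by rewrite -[LHS](divp_addl_mul_small _ szR) -GE divpD (divp_small szb) addr0.
rewrite -[LHS](modp_addl_mul_small (G %/ L \Po ('X + y%:P)) szR).
by rewrite -GE modpD (modp_small szb).
Qed.

(** Expansion in base L: the quotient of a W-periodic G by L is again
    W-periodic, and the remainder, of degree below #|W| and periodic, takes
    the value at 0 on all of W, so it is constant. *)
Lemma periodic_comp (F : finFieldType) (W : {set F}) (L G : {poly F}) :
  (1 < size L)%N -> (size L <= #|W|.+1)%N ->
  {in W, forall y, L \Po ('X + y%:P) = L} ->
  {in W, forall y, G \Po ('X + y%:P) = G} -> exists f, G = f \Po L.
Proof.
move=> szL szW Lper.
have [n] := ubnP (size G); elim: n => // n IHn in G *; rewrite ltnS => szG Gper.
have [divper modper] : {in W, forall y, (G %/ L) \Po ('X + y%:P) = G %/ L} /\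
    {in W, forall y, (G %% L) \Po ('X + y%:P) = G %% L}.
  split=> y Wy; have GE := Gper y Wy; rewrite -[RHS]addr0 in GE;
  by have [] := edivp_shift szL (Lper y Wy) GE; rewrite ?addr0.
have modC : G %% L = ((G %% L).[0])%:P.
  apply/eqP; rewrite -subr_eq0; apply: contraT => nz.
  have Wroots : all (root (G %% L - ((G %% L).[0])%:P)) (enum W).
    apply/allP => y; rewrite mem_enum => Wy.
    rewrite rootE hornerD hornerN hornerC.
    by rewrite -{2}(modper y Wy) horner_comp !hornerE subrr.
  have := max_poly_roots nz Wroots (enum_uniq W); rewrite -cardE ltnNge.
  rewrite -ltnS (leq_trans _ szW) // (leq_ltn_trans (size_polyD _ _)) //.
  rewrite gtn_max size_polyN (leq_ltn_trans (size_polyC_leq1 _)) // andbT.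
  by rewrite ltn_modp -size_poly_gt0 ltnW.
have [G0|nzG] := eqVneq G 0; first by exists 0; rewrite comp_poly0.
have [|f fE] := IHn (G %/ L) _ divper.
  apply: leq_trans szG; have nzL : L != 0 by rewrite -size_poly_gt0 ltnW.
  by rewrite size_divp // ltn_subrL size_poly_gt0 nzG -subn1 subn_gt0 szL.
exists (f * 'X + ((G %% L).[0])%:P).
by rewrite comp_polyD comp_polyM comp_polyX comp_polyC -fE -modC -divp_eq.
Qed.

(** * The set V of additive shifts *)

Lemma additive_shiftsP (F : finFieldType) (P : {poly F}) (y : F) :
  reflect (poly0 P \Po ('X + y%:P) = poly0 P + ((poly0 P).[y])%:P)
          (y \in additive_shifts P).
Proof. by rewrite inE !subr_eq add0r [_ + poly0 P]addrC; apply: eqP. Qed.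

Lemma poly0_horner0 (F : fieldType) (P : {poly F}) : (poly0 P).[0] = 0.
Proof. by rewrite /poly0 !hornerE subrr. Qed.

Lemma additive_shifts0 (F : finFieldType) (P : {poly F}) :
  0 \in additive_shifts P.
Proof.
by apply/additive_shiftsP; rewrite addr0 comp_polyXr poly0_horner0 addr0.
Qed.

Lemma additive_shiftsD (F : finFieldType) (P : {poly F}) (y z : F) :
  y \in additive_shifts P -> z \in additive_shifts P ->
  y + z \in additive_shifts P.
Proof.
move=> /additive_shiftsP Vy /additive_shiftsP Vz; apply/additive_shiftsP.
have PyzE : (poly0 P).[y + z] = (poly0 P).[y] + (poly0 P).[z].
  have := congr1 (fun q => q.[y]) Vz.
  by rewrite horner_comp !hornerE.
have -> : 'X + (y + z)%:P = ('X + y%:P) \Po ('X + z%:P) :> {poly F}.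
  by rewrite comp_polyD comp_polyX comp_polyC polyCD addrAC addrA.
by rewrite comp_polyA Vy comp_polyD comp_polyC Vz PyzE polyCD addrAC addrA.
Qed.

(** V is closed under addition and finite, so translation by y in V permutes
    the factors of the product over V. *)
Lemma shift_poly_periodic (F : finFieldType) (P : {poly F}) :
  {in additive_shifts P, forall y, shift_poly P \Po ('X + y%:P) = shift_poly P}.
Proof.
move=> y Vy; set V := additive_shifts P.
have imV : [set y + v | v in V] = V.
  apply/eqP; rewrite eqEcard card_imset ?leqnn ?andbT; last exact: addrI.
  by apply/subsetP => _ /imsetP[v Vv ->]; apply: additive_shiftsD.
rewrite /shift_poly -/V -[in LHS]imV big_imset /=; last first.
  by move=> ? ? _ _ /addrI.
rewrite rmorph_prod; apply: eq_bigr => v _ /=.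
by rewrite comp_polyB comp_polyX comp_polyC polyCD opprD addrA addrK.
Qed.

Lemma shift_poly_subspace (p : nat) (F : finFieldType) (P : {poly F}) :
  p \in [pchar F] -> subspace_poly p (shift_poly P).
Proof.
move=> charp; split.
- exact: monic_prod_XsubC.
- apply: (p_linearized_of_additive_on charp (additive_shifts0 P)).
    by rewrite size_prod_set.
  move=> y Vy; rewrite shift_poly_periodic //.
  have /rootP-> : root (shift_poly P) y by rewrite root_prod_set.
  by rewrite addr0.
- rewrite finField_genPoly.
  have -> : \prod_x ('X - x%:P) = \prod_(x in [set: F]) ('X - x%:P).
    by apply: eq_bigl => x; rewrite inE.
  by rewrite dvdp_prod_set subsetT.
Qed.

(** * Decomposability *)

Theorem theorem3p2 (p n : nat) (F : finFieldType) (P : {poly F})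
    (p_prime : prime p) (n_ge1 : (1 <= n)%N) (cardF : #|F| = (p ^ n)%N) :
  subspace_poly p (shift_poly P) /\
  (forall L : {poly F}, subspace_poly p L ->
     (decomposable p L P <-> L %| shift_poly P)).
Proof.
have charp : p \in [pchar F] := card_finPcharP cardF p_prime.
split=> [|L [monL linL dvdL]]; first exact: shift_poly_subspace.
have LE := subspace_poly_roots monL dvdL.
set W := [set x | root L x] in LE.
have W0 : 0 \in W.
  by rewrite inE; apply/rootP; exact: p_linearized_horner0 charp linL.
have szL : size L = #|W|.+1 by rewrite LE size_prod_set.
have szL1 : (1 < size L)%N by rewrite szL ltnS; apply/card_gt0P; exists (0 : F).
have Lroot : {in W, forall y, L.[y] = 0} by move=> y; rewrite inE => /rootP.
have Lper : {in W, forall y, L \Po ('X + y%:P) = L}.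
  by move=> y Wy; rewrite (p_linearized_shift y charp linL) Lroot ?addr0.
rewrite {2}LE dvdp_prod_set; split=> [[f [M [PE linM _]]]|/subsetP WV].
  apply/subsetP => y Wy; apply/additive_shiftsP.
  have M0 := p_linearized_horner0 charp linM.
  have P0E : poly0 P = f \Po L - (f.[0])%:P + M.
    by rewrite /poly0 PE hornerD horner_comp (Lroot 0 W0) M0 addr0 addrAC.
  have P0y : (poly0 P).[y] = M.[y].
    by rewrite P0E !hornerE horner_comp (Lroot y Wy) subrr add0r.
  rewrite P0y P0E comp_polyD comp_polyB comp_polyC -comp_polyA Lper //.
  by rewrite (p_linearized_shift y charp linM) addrA.
pose Q := poly0 P %/ L; pose M := poly0 P %% L.
have divW y : y \in W ->
    Q \Po ('X + y%:P) = Q /\ M \Po ('X + y%:P) = M + ((poly0 P).[y])%:P.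
  move=> Wy; apply: edivp_shift (Lper y Wy) _ => //.
  exact/additive_shiftsP/WV.
have szM : (size M < size L)%N by rewrite ltn_modp -size_poly_gt0 ltnW.
have linM : p_linearized p M.
  apply: (p_linearized_of_additive_on charp W0); first by rewrite -szL ltnW.
  move=> y Wy; rewrite (divW y Wy).2 [in LHS](divp_eq (poly0 P) L).
  by rewrite hornerD hornerM (Lroot y Wy) mulr0 add0r.
have [||f QE] := @periodic_comp _ W L Q szL1 _ Lper.
- by rewrite szL.
- by move=> y Wy; case: (divW y Wy).
exists (f * 'X + (P.[0])%:P), M; split=> //.
rewrite comp_polyD comp_polyM comp_polyX comp_polyC -QE addrAC -divp_eq.
by rewrite /poly0 subrK.
Qed.
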